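(* Let $\mathcal T$ be a trie and let $\omega$ be the number of edges (transitions) of the minimum Wheeler DFA recognizing the same language as $\mathcal T$. Then $r\le\omega$, where $r$ is the number of XBWT runs of $\mathcal T$.
   Context: A trie $\mathcal T$ is a rooted tree with $n$ nodes whose edges are labeled with characters of $\Sigma=\{1,\dots,\sigma\}$, totally ordered by $\prec$, such that the edges leaving any node carry pairwise distinct labels. $\lambda(\hat u)$ is the label of the edge entering $\hat u$; for the root it is $\#$, the $\prec$-smallest character, which labels no edge; every character of $\Sigma$ is $\lambda(\hat u)$ for some node. $out(\hat u)$ is the set of labels of edges leaving $\hat u$. Nodes are sorted co-lexicographically: $\hat u<\hat v$ iff the root-to-node label string of $\hat u$ precedes that of $\hat v$ when compared right-to-left with $\prec$; let $\hat u_1<\dots<\hat u_n$ be the sorted nodes. For $c\in\Sigma$ and $1\le i\le n$, $i$ is a $c$-run break if $c\in out(\hat u_i)$ and either $i=n$ or $c\notin out(\hat u_{i+1})$; $r$ is the total number of pairs $(i,c)$ with $i$ a $c$-run break. The trie is viewed as a DFA whose states are the nodes, whose transitions are the labeled edges, with the root as initial state and all states final; its language is the set of label strings of downward paths starting at the root. A Wheeler DFA is a DFA in which all transitions entering a given state have the same label and whose states admit a total order $<$ such that the initial state is first and, for any transitions $u'\xrightarrow{a}u$ and $v'\xrightarrow{b}v$: if $a\prec b$ then $u<v$, and if $a=b$ and $u'<v'$ then $u\le v$. The minimum Wheeler DFA is one with the minimum number of states among Wheeler DFAs recognizing the given language. *)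

(* Defs.v *)
From HB Require Import structures.
From mathcomp Require Import all_boot all_order.

Set Implicit Arguments.
Unset Strict Implicit.
Unset Printing Implicit Defensive.

Import Order.TTheory.

(* The alphabet is an arbitrary nonempty finite total order; the order of the
   alphabet is [<=%O] and the special character # is its least element [\bot]. *)

Section Trie.
Context {d : Order.disp_t} {Sigma : finTBOrderType d}.

(* A rooted tree, given by its parent map.  Every non-root node [v] stands for
   the edge from [parent v] to [v], labeled [lam v].  The root has no parent:
   [parent trie_root = trie_root] only makes the map total and is not an edge. *)
Record trie := Trie {
  node : finType;
  trie_root : node;
  parent : node -> node;
  lam : node -> Sigma;
  parent_root : parent trie_root = trie_root;
  root_ancestor : forall u, fconnect parent u trie_root;
  lam_root : lam trie_root = (\bot)%O;
  lam_nonroot : forall u, u != trie_root -> lam u != (\bot)%O;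
  lam_siblings : forall u v, u != trie_root -> v != trie_root ->
    parent u = parent v -> lam u = lam v -> u = v;
  lam_surj : forall c, exists u, lam u = c
}.

Definition edge (T : trie) (u : node T) (c : Sigma) (v : node T) : bool :=
  [&& v != trie_root T, parent v == u & lam v == c].

Definition out (T : trie) (u : node T) : {set Sigma} :=
  [set c | [exists v, edge u c v]].

(* [findex] is the depth of [u], so that the trajectory lists [u] and its
   proper ancestors up to, but excluding, the root. *)
Definition path_string (T : trie) (u : node T) : seq Sigma :=
  rev [seq lam v | v <- traject (@parent T) u (findex (@parent T) u (trie_root T))].

Definition colex_le (s t : seq Sigma) : bool :=
  ((rev s : seqlexi Sigma) <= (rev t : seqlexi Sigma))%O.

Definition sorted_nodes (T : trie) : seq (node T) :=
  sort (fun u v => colex_le (path_string u) (path_string v)) (enum (node T)).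

(* Positions are counted from 0: [nth_node T i] is the node of rank i + 1. *)
Definition nth_node (T : trie) (i : nat) : node T :=
  nth (trie_root T) (sorted_nodes T) i.

Definition run_break (T : trie) (c : Sigma) (i : 'I_#|node T|) : bool :=
  (c \in out (nth_node T i)) &&
  ((i.+1 == #|node T|) || (c \notin out (nth_node T i.+1))).

Definition xbwt_runs (T : trie) : nat :=
  #|[set p : 'I_#|node T| * Sigma | run_break p.2 p.1]|.

End Trie.

Arguments trie {d} Sigma.

Section Dfa.
Context {d : Order.disp_t} {Sigma : finTBOrderType d}.

(* The transition function is partial, as it is for a trie. *)
Record dfa := Dfa {
  state : finType;
  init : state;
  final : {set state};
  trans : state -> Sigma -> option state
}.

Fixpoint accepts_from (A : dfa) (q : state A) (w : seq Sigma) : bool :=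
  if w is a :: w' then
    if trans q a is Some q' then accepts_from q' w' else false
  else q \in final A.

Definition accepts (A : dfa) (w : seq Sigma) : bool := accepts_from (init A) w.

Definition same_language (A B : dfa) : Prop := accepts A =1 accepts B.

Definition num_transitions (A : dfa) : nat :=
  #|[set p : state A * Sigma | trans p.1 p.2 != None :> option (state A)]|.

Definition input_consistent (A : dfa) : Prop :=
  forall (u v w : state A) (a b : Sigma),
    trans u a = Some w -> trans v b = Some w -> a = b.

Definition wheeler_order (A : dfa) (le : rel (state A)) : Prop :=
  let lt u v := (u != v) && le u v in
  [/\ [/\ reflexive le, antisymmetric le, transitive le & total le],
      forall q, le (init A) q,
      forall (u' u v' v : state A) (a b : Sigma),
        trans u' a = Some u -> trans v' b = Some v -> (a < b)%O -> lt u v &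
      forall (u' u v' v : state A) (a : Sigma),
        trans u' a = Some u -> trans v' a = Some v -> lt u' v' -> le u v].

Definition wheeler (A : dfa) : Prop :=
  input_consistent A /\ exists le : rel (state A), wheeler_order le.

Definition minimum_wheeler_dfa (A B : dfa) : Prop :=
  [/\ wheeler A, same_language A B &
      forall C : dfa, wheeler C -> same_language C B -> #|state A| <= #|state C|].

End Dfa.

Arguments dfa {d} Sigma.

Definition trie_dfa {d : Order.disp_t} {Sigma : finTBOrderType d}
    (T : trie Sigma) : dfa Sigma :=
  {| state := node T;
     init := trie_root T;
     final := [set: node T];
     trans := fun u c => [pick v | edge u c v] |}.

(* Main.v *)
Require Import Defs.
From mathcomp Require Import all_boot all_order.

Set Implicit Arguments.
Unset Strict Implicit.
Unset Printing Implicit Defensive.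

Import Order.TTheory.

(* In any Wheeler DFA for the language of the trie, let f send a node to the
   state reached on its string.  Then f is monotone from the co-lexicographic
   order to the Wheeler order, and out u is determined by f u.  So for each c
   the map i |-> (f u_i, c) from c-run breaks to transitions is injective: if
   f u_i = f u_j with i < j, then f u_{i+1} = f u_i by monotonicity, hence
   c \in out u_{i+1} and i is not a c-run break. *)

Section Run.
Context {d : Order.disp_t} {Sigma : finTBOrderType d}.
Implicit Types (A : dfa Sigma) (T : trie Sigma).

(** A left fold lets the last letter be peeled off, which is where co-lexicographic comparison
    starts. *)
Definition run A (w : seq Sigma) : option (state A) :=
  foldl (fun oq a => obind (fun q => trans q a) oq) (Some (init A)) w.

Lemma run_rcons A w a :
  run A (rcons w a) = obind (fun q => trans q a) (run A w).
Proof. by rewrite /run foldl_rcons. Qed.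

Lemma accepts_run A w : accepts A w = oapp (mem (final A)) false (run A w).
Proof.
rewrite /accepts /run; move: (init A); elim: w => [|a w IHw] q //=.
(* Once stuck, the fold stays at [None] whatever letters follow. *)
by case: (trans q a) => [q'|] //; elim: w {IHw} => [|b w IHw].
Qed.

(** Induction on the reversed strings. Distinct last letters are settled by the first Wheeler axiom;
    equal ones lift the order of the states reached on the prefixes by the second. *)
Lemma run_colex_mono A (le : rel (state A)) s t p q : wheeler_order le ->
  colex_le s t -> run A s = Some p -> run A t = Some q -> le p q.
Proof.
case=> [[le_refl _ _ _] le_init le_lt le_eq].
rewrite /colex_le -[in run A s](revK s) -[in run A t](revK t).
elim: (rev s) (rev t) p q => {s t} [|a s IHs] [|b t] p q //.
- by move=> _ [<-].
- by move=> _ [<-].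
rewrite lexi_cons !rev_cons !run_rcons => /andP[le_ab le_st].
case run_s: (run A (rev s)) => [p'|] //= trans_p.
case run_t: (run A (rev t)) => [q'|] //= trans_q.
move: le_ab; rewrite le_eqVlt => /predU1P[eq_ab|lt_ab]; last first.
  by have /andP[] := le_lt _ _ _ _ _ _ trans_p trans_q lt_ab.
subst b; move: le_st; rewrite lexx /= => le_st.
(* The second axiom speaks of distinct predecessors only; equal ones have the same successor by
   determinism. *)
have [eq_pq|neq_pq] := eqVneq p' q'.
  by move: trans_q; rewrite -eq_pq trans_p => -[<-].
by apply: le_eq trans_p trans_q _; rewrite neq_pq (IHs _ _ _ le_st).
Qed.

Lemma edge_inj T (u v w : node T) c : edge u c v -> edge u c w -> v = w.
Proof.
case/and3P=> v_n0 /eqP pv /eqP lv /and3P[w_n0 /eqP pw /eqP lw].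
by apply: (lam_siblings v_n0 w_n0); rewrite ?pv ?pw ?lv ?lw.
Qed.

Lemma trie_trans T (u v : node T) c :
  edge u c v -> trans (u : state (trie_dfa T)) c = Some v.
Proof.
move=> uv /=; case: pickP => [w uw|/(_ v)]; last by rewrite uv.
by rewrite (edge_inj uv uw).
Qed.

Lemma path_string_root T : path_string (trie_root T) = [::].
Proof. by rewrite /path_string findex0. Qed.

Lemma path_string_parent T (u : node T) : u != trie_root T ->
  path_string u = rcons (path_string (parent u)) (lam u).
Proof.
move=> u_n0; rewrite /path_string (fconnect_findex (root_ancestor u)) 1?eq_sym //.
by rewrite trajectS map_cons rev_cons.
Qed.

Lemma run_trie T (u : node T) : run (trie_dfa T) (path_string u) = Some u.
Proof.
(* Induction on the depth of [u]. *)
elim: {u}(findex _ u _) {-2}u (erefl (findex (@parent _ _ T) u (trie_root T))).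
  by move=> u /eqP; rewrite findex_eq0 => /eqP->; rewrite path_string_root.
move=> n IHn u def_n.
have u_n0 : u != trie_root T by rewrite -(findex_eq0 (@parent _ _ T)) def_n.
have := fconnect_findex (root_ancestor u); rewrite eq_sym def_n.
move=> /(_ u_n0)[/esym/IHn run_pu].
by rewrite path_string_parent // run_rcons run_pu; apply: trie_trans;
   rewrite /edge u_n0 !eqxx.
Qed.

Lemma accepts_path_string T (u : node T) : accepts (trie_dfa T) (path_string u).
Proof. by rewrite accepts_run run_trie /= inE. Qed.

(** All states of the trie are final, so outgoing labels can be read off the language and transfer
    to any equivalent DFA. *)
Lemma in_out T (u : node T) c :
  (c \in out u) = accepts (trie_dfa T) (rcons (path_string u) c).
Proof.
rewrite accepts_run run_rcons run_trie inE /=.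
case: pickP => [v uv|no_edge] /=; first by rewrite inE; apply/existsP; exists v.
by apply/existsP => -[v]; rewrite no_edge.
Qed.

Definition state_of_node T A (u : node T) : state A :=
  odflt (init A) (run A (path_string u)).

(** Node strings are accepted, so the run of [A] on them never gets stuck. *)
Lemma run_state_of_node T A (u : node T) : same_language A (trie_dfa T) ->
  run A (path_string u) = Some (state_of_node A u).
Proof.
move=> /(_ (path_string u)); rewrite accepts_path_string accepts_run.
by rewrite /state_of_node; case: run.
Qed.

(** The right-hand side sees [u] only through its state: nodes sharing a state have the same
    outgoing labels. *)
Lemma in_out_state T A (u : node T) c : same_language A (trie_dfa T) ->
  (c \in out u) = oapp (mem (final A)) false (trans (state_of_node A u) c).
Proof.
by move=> eqL; rewrite in_out -eqL accepts_run run_rcons run_state_of_node.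
Qed.

Lemma colex_le_total : total (@colex_le d Sigma).
Proof. by move=> s t; apply: le_total. Qed.

Lemma colex_le_trans : transitive (@colex_le d Sigma).
Proof. by move=> s t u; apply: le_trans. Qed.

Lemma nth_node_colex T i j : i <= j < #|node T| ->
  colex_le (path_string (nth_node T i)) (path_string (nth_node T j)).
Proof.
case/andP=> le_ij lt_j; have lt_i := leq_ltn_trans le_ij lt_j.
have size_nodes : size (sorted_nodes T) = #|node T|.
  by rewrite size_sort cardE.
pose le_node (u v : node T) := colex_le (path_string u) (path_string v).
apply: (@sorted_leq_nth _ le_node _ _ _ (sorted_nodes T)); rewrite ?inE ?size_nodes //.
- by move=> u v w; apply: colex_le_trans.
- by move=> u; apply: lexx.
- by apply: sort_sorted => u v; apply: colex_le_total.
Qed.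

Theorem xbwt_runs_le_wheeler T A :
  wheeler A -> same_language A (trie_dfa T) -> xbwt_runs T <= num_transitions A.
Proof.
case=> _ [le wle] eqL; have [[_ le_anti _ _] _ _ _] := wle.
pose f i := state_of_node A (nth_node T i).
have f_mono i j : i <= j < #|node T| -> le (f i) (f j).
  move/nth_node_colex/(run_colex_mono wle).
  by apply; apply: run_state_of_node.
have f_inj c (i j : 'I_#|node T|) : i < j -> run_break c i -> f i != f j.
  move=> lt_ij /andP[c_i /orP[/eqP last_i|c_i1]].
    (* A break at the last position leaves no room for [j] above [i]. *)
    by have := ltn_ord j; rewrite -{2}last_i ltnS leqNgt lt_ij.
  apply: contra c_i1 => /eqP eq_f; have lt_j := ltn_ord j.
  suff eq_f1 : f i.+1 = f i.
    by rewrite (in_out_state _ _ eqL) -/(f _) eq_f1 -in_out_state.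
  (* [f i.+1] is squeezed between [f i] and [f j], which coincide. *)
  apply: le_anti; rewrite {1}eq_f !f_mono ?lt_ij ?leqnSn //.
  exact: leq_ltn_trans lt_j.
pose g (p : 'I_#|node T| * Sigma) := (f p.1, p.2).
have g_inj : {in [set p | run_break p.2 p.1] &, injective g}.
  move=> [i c] [j c']; rewrite !inE /= => bi bj [eq_f eq_c]; subst c'.
  have [lt_ij|lt_ji|/val_inj-> //] := ltngtP i j.
    by have := f_inj _ _ _ lt_ij bi; rewrite eq_f eqxx.
  by have := f_inj _ _ _ lt_ji bj; rewrite eq_f eqxx.
rewrite /xbwt_runs -(card_in_imset g_inj); apply/subset_leq_card/subsetP.
move=> _ /imsetP[[i c] + ->]; rewrite !inE /= => /andP[+ _].
(* A label in [out] leads [f i] to a final state, so the transition exists. *)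
by rewrite (in_out_state _ _ eqL) -/(f i); case: trans.
Qed.

End Run.

Theorem theorem3 (d : Order.disp_t) (Sigma : finTBOrderType d)
    (T : trie Sigma) (A : dfa Sigma)
    (hA : minimum_wheeler_dfa A (trie_dfa T)) :
  xbwt_runs T <= num_transitions A.
Proof. by case: hA => wA eqL _; apply: xbwt_runs_le_wheeler. Qed.
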